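(* Let $\mu_{\mathbf X}$ and $\mu_{\mathbf Y}$ be Borel probability measures on $\mathbb{R}^n$ and $\mathbb{R}^m$ (reference measures) and let $\mu_{\mathbf U,\mathbf F}$ be a Borel probability measure on $\mathbb{R}^{n}\times\mathbb{R}^m$ (target measure). Let $\check F:\mathbb{R}^{n+m}\to\mathbb{R}^{n+m}$ be an invertible lower-triangular map with inverse $\check G$, and let $\hat F:\mathbb{R}^{n+m}\to\mathbb{R}^{n+m}$ be an invertible upper-triangular map with inverse $\hat G$, such that $$\check F_\#(\mu_{\mathbf X}\otimes\mu_{\mathbf Y})=\mu_{\mathbf U,\mathbf F},\qquad \hat F_\#(\mu_{\mathbf X}\otimes\mu_{\mathbf Y})=\mu_{\mathbf U,\mathbf F}.$$ For $\mathbf u\in\mathbb{R}^n$, $\mathbf f\in\mathbb{R}^m$ set $$F_{\text{like}}(\cdot;\mathbf u):=\check F_2(\check F_1^{-1}(\mathbf u),\cdot),\quad F_{\text{like}}^{-1}(\cdot;\mathbf u):=\check G_2(\mathbf u,\cdot),\qquad F_{\text{post}}(\cdot;\mathbf f):=\hat F_1(\cdot,\hat F_2^{-1}(\mathbf f)),\quad F_{\text{post}}^{-1}(\cdot;\mathbf f):=\hat G_1(\cdot,\mathbf f).$$ Define the map $S=(S_1,S_2):\mathbb{R}^{n+m}\to\mathbb{R}^{n+m}$ by $$S_1(\mathbf u,\mathbf y)=F_{\text{post}}^{-1}\bigl(\mathbf u;F_{\text{like}}(\mathbf y;\mathbf u)\bigr),\qquad S_2(\mathbf u,\mathbf y)=F_{\text{like}}(\mathbf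 y;\mathbf u),$$ and the map $R=(R_1,R_2):\mathbb{R}^{n+m}\to\mathbb{R}^{n+m}$ by $$R_1(\mathbf x,\mathbf f)=F_{\text{post}}(\mathbf x;\mathbf f),\qquad R_2(\mathbf x,\mathbf f)=F_{\text{like}}^{-1}\bigl(\mathbf f;F_{\text{post}}(\mathbf x;\mathbf f)\bigr).$$ Then $S$ is invertible with inverse $R$, and $S$ is a Reversible Simulator for the reference and target measures $\mu_{\mathbf X},\mu_{\mathbf Y}$ and $\mu_{\mathbf U,\mathbf F}$.
   Context: Points of $\mathbb{R}^{n+m}=\mathbb{R}^n\times\mathbb{R}^m$ are written as pairs with first component in $\mathbb{R}^n$ and second in $\mathbb{R}^m$; maps into $\mathbb{R}^{n+m}$ are split accordingly as $F=(F_1,F_2)$. Lower-triangular maps: $F:\mathbb{R}^{n+m}\to\mathbb{R}^{n+m}$ is lower-triangular if its Jacobian is a lower-triangular matrix; splitting variables, $F(\mathbf x,\mathbf y)=(F_1(\mathbf x),F_2(\mathbf x,\mathbf y))$ with $F_1:\mathbb{R}^n\to\mathbb{R}^n$, $F_2:\mathbb{R}^{n+m}\to\mathbb{R}^m$. It is an invertible lower-triangular map if it is invertible and its inverse $G=F^{-1}$ is also lower-triangular, $G(\mathbf u,\mathbf f)=(G_1(\mathbf u),G_2(\mathbf u,\mathbf f))$; then $G_1=F_1^{-1}$, $G_2(\mathbf u,F_2(G_1(\mathbf u),\mathbf y))=\mathbf y$ and $F_2(\mathbf x,G_2(F_1(\mathbf x),\mathbf f))=\mathbf f$. Upper-triangular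 maps: $F$ is upper-triangular if its Jacobian is an upper-triangular matrix; splitting variables, $F(\mathbf x,\mathbf y)=(F_1(\mathbf x,\mathbf y),F_2(\mathbf y))$. It is an invertible upper-triangular map if it is invertible and its inverse $G$ is upper-triangular, $G(\mathbf u,\mathbf f)=(G_1(\mathbf u,\mathbf f),G_2(\mathbf f))$; then $G_2=F_2^{-1}$, $G_1(F_1(\mathbf x,G_2(\mathbf f)),\mathbf f)=\mathbf x$ and $F_1(G_1(\mathbf u,F_2(\mathbf y)),\mathbf y)=\mathbf u$. Measures: $\mu_{\mathbf U}$ and $\mu_{\mathbf F}$ denote the marginals of $\mu_{\mathbf U,\mathbf F}$ on $\mathbb{R}^n$ and $\mathbb{R}^m$. $\mu_{\mathbf F|\mathbf U=\mathbf u}$ and $\mu_{\mathbf U|\mathbf F=\mathbf f}$ denote the conditional measures (disintegrations) of $\mu_{\mathbf U,\mathbf F}$ with respect to $\mu_{\mathbf U}$ and $\mu_{\mathbf F}$. Since disintegrations are unique only up to null sets, an identity involving $\mu_{\mathbf F|\mathbf U=\mathbf u}$ (resp. $\mu_{\mathbf U|\mathbf F=\mathbf f}$) is understood for $\mu_{\mathbf U}$-a.e. $\mathbf u$ (resp. $\mu_{\mathbf F}$-a.e. $\mathbf f$). $T_\#\mu=\mu\circ T^{-1}$ is the push-forward, $\otimes$ the product measure. Reversible Simulator: an invertible map $S=(S_1,S_2):\mathbb{R}^{n+m}\to\mathbb{R}^{n+m}$ (Borel, with Borel inverse) with inverse $R=(R_1,R_2)$ is a Reversible Simulator for reference measures $\mu_{\mathbf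 X},\mu_{\mathbf Y}$ and target measure $\mu_{\mathbf U,\mathbf F}$ if: (i) $(S_2(\mathbf u,\cdot))_\#\mu_{\mathbf Y}=\mu_{\mathbf F|\mathbf U=\mathbf u}$; (ii) $(R_1(\cdot,\mathbf f))_\#\mu_{\mathbf X}=\mu_{\mathbf U|\mathbf F=\mathbf f}$; (iii) $S_\#(\mu_{\mathbf U}\otimes\mu_{\mathbf Y})=\mu_{\mathbf X}\otimes\mu_{\mathbf F}$; (iv) $R_\#(\mu_{\mathbf X}\otimes\mu_{\mathbf F})=\mu_{\mathbf U}\otimes\mu_{\mathbf Y}$. *)

(* Defs.v *)
From HB Require Import structures.
From mathcomp Require Import all_boot all_order all_algebra.
From mathcomp Require Import all_classical all_reals all_analysis.

Set Implicit Arguments.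
Unset Strict Implicit.
Unset Printing Implicit Defensive.

Import Order.TTheory GRing.Theory Num.Theory.
Import numFieldNormedType.Exports.

Local Open Scope classical_set_scope.
Local Open Scope ring_scope.

(* Borel sigma-algebra of the usual topology.  A product 'rV_n * 'rV_m carries
   the library's product sigma-algebra, which is its Borel sigma-algebra
   because the factors are second countable. *)
HB.instance Definition _ (R : realType) (n : nat) :=
  let opens := [set A : set 'rV[R]_n | open A] in
  @isMeasurable.Build (sigma_display opens) 'rV[R]_n <<s opens >>
    (@sigma_algebra0 _ setT opens) (@sigma_algebraC _ opens)
    (@sigma_algebra_bigcup _ setT opens).

HB.instance Definition _ d1 d2 (T1 : measurableType d1)
    (T2 : measurableType d2) :=
  isMeasurableFun.Build _ _ _ _ (@fst T1 T2) measurable_fst.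

HB.instance Definition _ d1 d2 (T1 : measurableType d1)
    (T2 : measurableType d2) :=
  isMeasurableFun.Build _ _ _ _ (@snd T1 T2) measurable_snd.

Definition is_inverse (A B : Type) (f : A -> B) (g : B -> A) : Prop :=
  cancel f g /\ cancel g f.

Section triangular_maps.
Context {R : realType} {n m : nat}.
Local Notation RnRm := ('rV[R]_n * 'rV[R]_m)%type.
Implicit Types F G : RnRm -> RnRm.

Definition flatten_map F (v : 'rV[R]_(n + m)) : 'rV[R]_(n + m) :=
  let q := F (lsubmx v, rsubmx v) in row_mx q.1 q.2.

(* The library's 'J acts on row vectors, so its entry (i, j) is the derivative
   of the j-th component in the i-th variable; the transpose is the usual
   Jacobian matrix. *)
Definition Jacobian F (v : 'rV[R]_(n + m)) : 'M[R]_(n + m) :=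
  ('J (flatten_map F) v)^T.

(* is_trig_mx is lower triangularity. *)
Definition lower_triangular F : Prop :=
  forall v, differentiable (flatten_map F) v /\ is_trig_mx (Jacobian F v).

Definition upper_triangular F : Prop :=
  forall v, differentiable (flatten_map F) v /\ is_trig_mx (Jacobian F v)^T.

Definition invertible_lower_triangular F G : Prop :=
  [/\ is_inverse F G, lower_triangular F & lower_triangular G].

Definition invertible_upper_triangular F G : Prop :=
  [/\ is_inverse F G, upper_triangular F & upper_triangular G].

(* The component F_1 of F (x, y) = (F_1 x, F_2 (x, y)); for a lower-triangular F
   the value 0 given to the second variable is irrelevant. *)
Definition lower_fst F (x : 'rV[R]_n) : 'rV[R]_n := (F (x, 0)).1.

(* Likewise F_2 in F (x, y) = (F_1 (x, y), F_2 y), for F upper-triangular. *)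
Definition upper_snd F (y : 'rV[R]_m) : 'rV[R]_m := (F (0, y)).2.

End triangular_maps.

Section simulator_maps.
Context {R : realType} {n m : nat}.
Local Notation Rn := 'rV[R]_n.
Local Notation Rm := 'rV[R]_m.
Local Notation RnRm := (Rn * Rm)%type.

Definition F_like (lowF : RnRm -> RnRm) (u : Rn) (y : Rm) : Rm :=
  (lowF ('pinv_(fun=> 0) setT (lower_fst lowF) u, y)).2.

Definition F_like_inv (lowG : RnRm -> RnRm) (u : Rn) (f : Rm) : Rm :=
  (lowG (u, f)).2.

Definition F_post (upF : RnRm -> RnRm) (f : Rm) (x : Rn) : Rn :=
  (upF (x, 'pinv_(fun=> 0) setT (upper_snd upF) f)).1.

Definition F_post_inv (upG : RnRm -> RnRm) (f : Rm) (u : Rn) : Rn :=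
  (upG (u, f)).1.

Definition simulator_S (lowF upG : RnRm -> RnRm) (p : RnRm) : RnRm :=
  let: (u, y) := p in
  (F_post_inv upG (F_like lowF u y) u, F_like lowF u y).

Definition simulator_R (lowG upF : RnRm -> RnRm) (p : RnRm) : RnRm :=
  let: (x, f) := p in
  (F_post upF f x, F_like_inv lowG (F_post upF f x) f).

End simulator_maps.

Definition same_measure d (T : measurableType d) (R : realType)
    (mu nu : set T -> \bar R) : Prop :=
  forall A, measurable A -> mu A = nu A.

Section conditional_measures.
Context {d1 d2 : measure_display} {T1 : measurableType d1}
  {T2 : measurableType d2} {R : realType}.
Variable mu : probability (T1 * T2)%type R.
Local Open Scope ereal_scope.

Definition marginal1 : probability T1 R := distribution mu fst.
Definition marginal2 : probability T2 R := distribution mu snd.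

Definition disintegration1 (k : R.-pker T1 ~> T2) : Prop :=
  forall C, measurable C ->
    mu C = \int[marginal1]_x k x (xsection C x).

Definition disintegration2 (k : R.-pker T2 ~> T1) : Prop :=
  forall C, measurable C ->
    mu C = \int[marginal2]_y k y (ysection C y).

(* nu u = mu_{2 | 1 = u} for almost every u.  The statement is about every
   version of the conditional measure; existence is also required, so that it
   cannot hold vacuously. *)
Definition conditional_measure1 (nu : T1 -> set T2 -> \bar R) : Prop :=
  (exists k, disintegration1 k) /\
  forall k, disintegration1 k ->
    {ae marginal1, forall u, same_measure (nu u) (k u)}.

Definition conditional_measure2 (nu : T2 -> set T1 -> \bar R) : Prop :=
  (exists k, disintegration2 k) /\
  forall k, disintegration2 k ->
    {ae marginal2, forall f, same_measure (nu f) (k f)}.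

End conditional_measures.

Record reversible_simulator {R : realType} {n m : nat}
    (muX : probability 'rV[R]_n R) (muY : probability 'rV[R]_m R)
    (muUF : probability ('rV[R]_n * 'rV[R]_m)%type R)
    (S S' : 'rV[R]_n * 'rV[R]_m -> 'rV[R]_n * 'rV[R]_m) : Prop := {
  rs_inverse : is_inverse S S' ;
  rs_measurable : measurable_fun setT S ;
  rs_inv_measurable : measurable_fun setT S' ;
  rs_likelihood : conditional_measure1 muUF
    (fun u => pushforward muY (fun y => (S (u, y)).2)) ;
  rs_posterior : conditional_measure2 muUF
    (fun f => pushforward muX (fun x => (S' (x, f)).1)) ;
  rs_forward : same_measure
    (pushforward (marginal1 muUF \x muY)%E S)
    (muX \x marginal2 muUF)%E ;
  rs_backward : same_measure
    (pushforward (muX \x marginal2 muUF)%E S')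
    (marginal1 muUF \x muY)%E }.

(* Main.v *)
From HB Require Import structures.
Require Import Defs.
From mathcomp Require Import all_boot all_order all_algebra.
From mathcomp Require Import all_classical all_reals all_analysis.
From mathcomp Require Import measurable_realfun.

(* Write T (u, y) = (u, F_like u y) and W (x, f) = (F_post f x, f); both are
   bijections of R^n * R^m, with inverses built from lowG and upG, and
   S = W^-1 o T, R = T^-1 o W.  Since lowF (x, y) = T (F_1 x, y), where F_1
   pushes muX forward to the first marginal of muUF, the map T pushes
   marginal1 muUF \x muY forward to muUF; likewise W pushes
   muX \x marginal2 muUF forward to muUF.  Applying W^-1 and T^-1 gives (iii)
   and (iv), and reading the two push-forward identities section by section
   says that the laws of F_like u and F_post f are disintegrations of muUF.
   Disintegrations are almost everywhere unique because the Borel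
   sigma-algebra of R^k is generated by a countable pi-system. *)

Set Implicit Arguments.
Unset Strict Implicit.
Unset Printing Implicit Defensive.

Import Order.TTheory GRing.Theory Num.Theory.
Import numFieldNormedType.Exports.

Local Open Scope classical_set_scope.
Local Open Scope ring_scope.

(** * Borel measurability of maps into spaces of row vectors *)

Lemma measurable_rV_ball d (T : measurableType d) (R : realType) (k : nat)
    (f : T -> 'rV[R]_k) (c : 'rV[R]_k) (e : R) :
  (forall i, measurable_fun setT (fun t => f t 0 i)) ->
  measurable (f @^-1` ball c e).
Proof.
(* A matrix ball includes [0 < e] in its definition, whereas for [k = 0] the intersection of
   coordinate balls is everything. *)
move=> mf; case: (ltP 0 e) => e0; last first.
  rewrite (_ : _ @^-1` _ = set0)//; apply/seteqP; split => // t [].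
  by rewrite ltNge e0.
rewrite (_ : _ @^-1` _ =
    \bigcap_(i in [set: 'I_k]) ((fun t => f t 0 i) @^-1` ball (c 0 i) e)).
  apply: fin_bigcap_measurable => // i _.
  rewrite -[X in measurable X]setTI; apply: mf => //.
  rewrite ball_itv; exact: measurable_itv.
apply/seteqP; split => [t [_ tc] i _|t tc]; first exact: tc.
by split => // i j; rewrite ord1; exact: tc.
Qed.

(** Rational centres are dense and the radii tend to zero; the index type is countable, as a
    sigma-algebra argument requires. *)
Lemma open_rV_bigcup_ball (R : realType) (k : nat) (U : set 'rV[R]_k) :
  open U ->
  U = \bigcup_(p in [set p : 'rV[rat]_k * nat |
                      ball (map_mx ratr p.1 : 'rV[R]_k) p.2.+1%:R^-1 `<=` U])
        ball (map_mx ratr p.1 : 'rV[R]_k) p.2.+1%:R^-1.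
Proof.
move=> oU; apply/seteqP; split => [x Ux|x [p pU /pU//]].
have /nbhs_ballP[e /= e0 xeU] : nbhs x U by exact: open_nbhs_nbhs.
(* Half the radius, so that a centre within [r.+1%:R^-1] of [x] has its ball of that radius inside
   [ball x e]. *)
have [r /= re] : exists r : nat, r.+1%:R^-1 < e / 2.
  have /ltr_add_invr[r]: 0 < e / 2 by rewrite divr_gt0.
  by rewrite add0r; exists r.
have r0 : (0 : R) < r.+1%:R^-1 by rewrite invr_gt0.
have /choice[q qx] : forall i, exists q : rat, `|x 0 i - ratr q| < r.+1%:R^-1.
  move=> i; have /rat_in_itvoo[q]: x 0 i - r.+1%:R^-1 < x 0 i + r.+1%:R^-1.
    by rewrite ltrD2l (lt_trans _ r0)// oppr_lt0.
  rewrite in_itv/= => qx; exists q.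
  by rewrite distrC ltr_distl.
exists (\row_i q i, r) => /=; last first.
  by split => // i j; rewrite ord1 !mxE /ball/= distrC.
move=> y [_ qy]; apply: xeU; split => // i j; rewrite ord1.
have := qy 0 j; rewrite /ball/= !mxE => {}qy.
rewrite -(subrK (ratr (q j)) (x 0 j)) -addrA (le_lt_trans (ler_normD _ _))//.
by rewrite (splitr e) ltrD// (lt_trans _ re).
Qed.

Lemma measurable_fun_rV d (T : measurableType d) (R : realType) (k : nat)
    (f : T -> 'rV[R]_k) :
  (forall i, measurable_fun setT (fun t => f t 0 i)) -> measurable_fun setT f.
Proof.
move=> mf; apply: (measurability [set A : set 'rV[R]_k | open A]) => //.
move=> _ [U /= /open_rV_bigcup_ball -> <-]; rewrite setTI preimage_bigcup.
(* Indices whose ball is not inside the open set contribute the empty set, so the union runs over a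
   whole countable type. *)
rewrite bigcup_mkcond; apply: countable_bigcupT_measurable => // p.
by case: ifP => // _; exact: measurable_rV_ball.
Qed.

Lemma continuous_measurable_rV (R : realType) (k : nat) (f : 'rV[R]_k -> R) :
  continuous f -> measurable_fun setT f.
Proof.
move=> /continuousP cf.
apply: (measurability _ (RGenOpens.measurableE R)) => //.
move=> _ [_ [a [b ->] <-]]; rewrite setTI.
by apply: sub_sigma_algebra; apply: cf; exact: interval_open.
Qed.

(** [w *m 'J f a] is the derivative of [f] at [a] in direction [w], so coordinate [i] has zero
    derivative along the line from [v] to [v + w]. *)
Lemma coord_cst_along (R : realType) (p q : nat) (f : 'rV[R]_p -> 'rV[R]_q)
    (v w : 'rV[R]_p) (i : 'I_q) :
  (forall a, differentiable f a) -> (forall a, (w *m 'J f a) 0 i = 0) ->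
  f (v + w) 0 i = f v 0 i.
Proof.
move=> df Jw0; pose g (t : R) := f (v + t *: w) 0 i.
suff g0 t : is_derive t (1 : R) g 0.
  by have := is_derive_0_is_cst 1 0 g0; rewrite /g scale1r scale0r addr0.
have g'0 :
    h^-1 *: ((g \o shift t) (h *: (1 : R)) - g t) @[h --> 0^'] --> (0 : R).
  have dw : derivable f (v + t *: w) w by exact: diff_derivable.
  rewrite -[X in _ --> X](Jw0 (v + t *: w)) -deriveEjacobian//.
  have := cvg_comp _ _ dw (@coord_continuous R 1 q 0 i _).
  apply: cvg_trans; apply: near_eq_cvg; near=> h.
  by rewrite /g/= !mxE [h%:A]mulr1 scalerDl addrCA.
by apply: DeriveDef; [apply/cvg_ex; exists 0|exact: cvg_lim].
Unshelve. all: by end_near. Qed.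

Lemma measurable_coord (R : realType) (k : nat) (i : 'I_k) :
  measurable_fun setT (fun v : 'rV[R]_k => v 0 i).
Proof. exact: continuous_measurable_rV (@coord_continuous R 1 k 0 i). Qed.

Lemma measurable_row_mx d (T : measurableType d) (R : realType) (n m : nat)
    (f : T -> 'rV[R]_n) (g : T -> 'rV[R]_m) :
  measurable_fun setT f -> measurable_fun setT g ->
  measurable_fun setT (fun t => row_mx (f t) (g t)).
Proof.
move=> mf mg; apply: measurable_fun_rV => i.
have [j ->|j ->] := split_ordP i.
  have := measurableT_comp (measurable_coord j) mf.
  by congr measurable_fun; apply/funext => t /=; rewrite row_mxEl.
have := measurableT_comp (measurable_coord j) mg.
by congr measurable_fun; apply/funext => t /=; rewrite row_mxEr.
Qed.

(** * From triangular Jacobians to dependence on variables *)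

Section triangular.
Context {R : realType} {n m : nat}.
Local Notation RnRm := ('rV[R]_n * 'rV[R]_m)%type.
Implicit Types F G : RnRm -> RnRm.

Lemma flatten_map_row_mx F x y :
  flatten_map F (row_mx x y) = row_mx (F (x, y)).1 (F (x, y)).2.
Proof. by rewrite /flatten_map row_mxKl row_mxKr. Qed.

(** The derivatives of the first [n] components in the last [m] variables lie above the diagonal of
    the Jacobian, hence vanish; the direction [(0, y - y')] involves no others. *)
Lemma lower_triangular_fst F x y y' :
  lower_triangular F -> (F (x, y)).1 = (F (x, y')).1.
Proof.
move=> tF; apply/rowP => i.
have := @coord_cst_along R _ _ (flatten_map F) (row_mx x y')
  (row_mx 0 (y - y')) (lshift m i) (fun a => (tF a).1).
rewrite add_row_mx addr0 subrKC !flatten_map_row_mx !row_mxEl; apply => a.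
rewrite mxE big_split_ord/= !big1 ?addr0// => j _; last first.
  by rewrite row_mxEl mxE mul0r.
have /is_trig_mxP/(_ (lshift m i) (rshift n j)) := (tF a).2.
rewrite mxE => ->; first by rewrite mulr0.
by rewrite /= ltn_addr.
Qed.

Lemma upper_triangular_snd F x x' y :
  upper_triangular F -> (F (x, y)).2 = (F (x', y)).2.
Proof.
move=> tF; apply/rowP => i.
have := @coord_cst_along R _ _ (flatten_map F) (row_mx x' y)
  (row_mx (x - x') 0) (rshift n i) (fun a => (tF a).1).
rewrite add_row_mx addr0 subrKC !flatten_map_row_mx !row_mxEr; apply => a.
rewrite mxE big_split_ord/= !big1 ?addr0// => j _.
  by rewrite row_mxEr mxE mul0r.
have /is_trig_mxP/(_ (lshift m j) (rshift n i)) := (tF a).2.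
rewrite !mxE => ->; first by rewrite mulr0.
by rewrite /= ltn_addr.
Qed.

(** The coordinates of [F] are those of the flattened map, which are continuous, composed with the
    measurable concatenation. *)
Lemma measurable_flatten_map F :
  (forall v, differentiable (flatten_map F) v) -> measurable_fun setT F.
Proof.
move=> dF.
have mrow : measurable_fun setT (fun p : RnRm => row_mx p.1 p.2).
  exact: measurable_row_mx measurable_fst measurable_snd.
have cF i : continuous (fun v => flatten_map F v 0 i).
  move=> v; apply: (@continuous_comp _ _ _ (flatten_map F)
    (fun M : 'rV[R]_(n + m) => M 0 i)); last exact: coord_continuous.
  exact: differentiable_continuous.
have mF i := measurableT_comp (continuous_measurable_rV (cF i)) mrow.
apply/measurable_fun_pairP; split; apply: measurable_fun_rV => i.
  have := mF (lshift m i); congr measurable_fun; apply/funext => -[x y] /=.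
  by rewrite flatten_map_row_mx row_mxEl.
have := mF (rshift n i); congr measurable_fun; apply/funext => -[x y] /=.
by rewrite flatten_map_row_mx row_mxEr.
Qed.

End triangular.

(** * Almost everywhere uniqueness of disintegrations *)

Definition countable_pi_base d (T : measurableType d) (G : (set T)^nat) :=
  [/\ measurable = <<s range G >>, setI_closed (range G) &
      \bigcup_n G n = setT].

Section disintegration.
Context d1 d2 (T1 : measurableType d1) (T2 : measurableType d2) (R : realType).
Variable mu : probability (T1 * T2)%type R.
Local Open Scope ereal_scope.

Lemma disintegration1_setX (k : R.-pker T1 ~> T2) A B :
  disintegration1 mu k -> measurable A -> measurable B ->
  mu (A `*` B) = \int[marginal1 mu]_(x in A) k x B.
Proof.
move=> dk mA mB; rewrite dk; last exact: measurableX.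
rewrite [RHS]integral_mkcond; apply: eq_integral => x _; rewrite /patch.
case: ifPn => xA; first by rewrite in_xsectionX.
by rewrite notin_xsectionX// measure0.
Qed.

(** On each set of the base the two kernels have equal integrals over every measurable set, so they
    agree almost everywhere. The countably many exceptional sets have a null union, outside which
    agreement on the pi-system identifies the measures. *)
Lemma disintegration1_ae_unique (G : (set T2)^nat) (k l : R.-pker T1 ~> T2) :
  countable_pi_base G -> disintegration1 mu k -> disintegration1 mu l ->
  {ae marginal1 mu, forall x, same_measure (k x) (l x)}.
Proof.
move=> [mG GI GT] dk dl.
have mGn n : measurable (G n).
  by rewrite mG; apply: sub_sigma_algebra; exists n.
have : \forall x \ae marginal1 mu, forall n, k x (G n) = l x (G n).
  apply: ae_foralln => n.
  have : ae_eq (marginal1 mu) setT (k ^~ (G n)) (l ^~ (G n)).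
    apply: integral_ae_eq => //.
    (* Kernel values are at most 1 and the marginal is finite. *)
    - apply/integrableP; split; first exact: measurable_kernel.
      apply: (@le_lt_trans _ _ (\int[marginal1 mu]_x cst 1 x)).
        apply: ge0_le_integral => //.
        + apply: measurableT_comp => //; exact: measurable_kernel.
        + move=> x _; rewrite gee0_abs// -(@prob_kernel _ _ _ _ _ k x).
          by rewrite le_measure ?inE.
      rewrite integral_cst// mul1e.
      by rewrite (le_lt_trans (probability_le1 (marginal1 mu) _))// ltry.
    - exact: measurable_kernel.
    - by move=> E _ mE; rewrite -!disintegration1_setX.
  by apply: filterS => x /(_ I).
apply: filterS => x kl A mA.
apply: (@measure_unique _ _ _ (range G) G mG GI
  (fun n => ex_intro2 _ _ n I erefl) GT) => //.
- by move=> _ [n _ <-].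
- move=> n; apply: (@le_lt_trans _ _ 1); last by rewrite ltry.
  by rewrite -(@prob_kernel _ _ _ _ _ k x) le_measure ?inE.
Qed.

End disintegration.

(** * A countable pi-system generating the Borel sets *)

Section quadrant.
Context {R : realType} {m : nat}.

(* Unlike balls, these sets are stable under intersection. *)
Definition quadrant (q : 'rV[rat]_m) : set 'rV[R]_m :=
  [set y | forall i, y 0 i < ratr (q 0 i)].

Lemma quadrantI p q : quadrant p `&` quadrant q =
  quadrant (\row_i Num.min (p 0 i) (q 0 i)).
Proof.
apply/seteqP; split => [y [py qy] i|y pqy].
  by rewrite mxE; case: (leP (p 0 i) (q 0 i)).
by split=> i; rewrite (lt_le_trans (pqy i))// mxE ler_rat ge_min lexx ?orbT.
Qed.

Lemma quadrant_approx (x y : 'rV[R]_m) : (forall i, y 0 i < x 0 i) ->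
  exists q, quadrant q y /\ forall i, ratr (q 0 i) <= x 0 i.
Proof.
move=> yx.
have /choice[q qyx] : forall i, exists q : rat, y 0 i < ratr q < x 0 i.
  by move=> i; have /rat_in_itvoo[q] := yx i; rewrite in_itv; exists q.
exists (\row_i q i); split => i; rewrite mxE; have /andP[//] := qyx i.
by move=> _ /ltW.
Qed.

Lemma measurable_quadrant q : measurable (quadrant q).
Proof.
rewrite (_ : quadrant q = \bigcap_(i in [set: 'I_m])
    ((fun y : 'rV[R]_m => y 0 i) @^-1` `]-oo, ratr (q 0 i)[)).
  apply: fin_bigcap_measurable => // i _.
  by rewrite -[X in measurable X]setTI; apply: measurable_coord.
apply/seteqP; split => [y qy i _|y qy i]; first by rewrite /= in_itv/= qy.
by have := qy i I; rewrite /= in_itv.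
Qed.

(** The harder inclusion is measurability of the identity out of the sigma-algebra generated by
    quadrants. It is tested on half-spaces bounding one coordinate from above, each a countable
    union of quadrants. *)
Lemma measurable_rVE_quadrant :
  @measurable _ 'rV[R]_m = <<s range quadrant >>.
Proof.
apply/seteqP; split; last first.
  apply: smallest_sub; first exact: sigma_algebra_measurable.
  by move=> _ [q _ <-]; exact: measurable_quadrant.
pose T := g_sigma_algebraType (range quadrant).
suff mid : measurable_fun [set: T] (id : T -> 'rV[R]_m).
  by move=> A mA; have := mid measurableT _ mA; rewrite setTI.
apply: measurable_fun_rV => i.
apply: (measurability _ (RGenInftyO.measurableE R)) => //.
move=> _ [_ [x ->] <-]; rewrite setTI.
rewrite (_ : _ @^-1` _ =
    \bigcup_(q in [set q : 'rV[rat]_m | ratr (q 0 i) <= x]) quadrant q).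
  rewrite bigcup_mkcond; apply: countable_bigcupT_measurable => // q.
  by case: ifP => // _; apply: sub_sigma_algebra; exists q.
apply/seteqP; split => [y/=|y [q /= qx qy]]; rewrite in_itv/=; last first.
  exact: lt_le_trans qx.
move=> yx.
(* Only coordinate [i] is capped by [x]; elsewhere [y 0 j + 1] leaves room for a rational above
   [y 0 j]. *)
have [] := @quadrant_approx (\row_j if j == i then x else y 0 j + 1) y.
  by move=> j; rewrite mxE; case: eqP => [->//|_]; rewrite ltrDl.
by move=> q [qy /(_ i)]; rewrite mxE eqxx; exists q.
Qed.

Lemma rV_countable_pi_base :
  exists G : (set 'rV[R]_m)^nat, countable_pi_base G.
Proof.
(* Codes that decode to nothing give the quadrant at 0, so the range is still that of all
   quadrants. *)
exists (fun n => quadrant (odflt 0 (unpickle n))).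
have rangeE : range (fun n => quadrant (odflt 0 (unpickle n))) = range quadrant.
  apply/seteqP; split => _ [x _ <-]; first by exists (odflt 0 (unpickle x)).
  by exists (pickle x) => //; rewrite pickleK.
split; first by rewrite rangeE measurable_rVE_quadrant.
  rewrite rangeE => _ _ [p _ <-] [q _ <-]; rewrite quadrantI.
  by exists (\row_i Num.min (p 0 i) (q 0 i)).
apply/seteqP; split => // y _.
have [|q [qy _]] := @quadrant_approx (\row_j (y 0 j + 1)) y.
  by move=> i; rewrite mxE ltrDl.
by exists (pickle q) => //; rewrite pickleK.
Qed.

End quadrant.

(** * Kernels pushing a fixed law through the sections of a map *)

Section image_kernel.
Context d1 d2 d3 (T1 : measurableType d1) (T2 : measurableType d2)
  (T3 : measurableType d3) (R : realType).
Variables (P : probability T2 R) (L : T1 * T2 -> T3).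
Hypothesis mL : measurable_fun setT L.
Local Open Scope ereal_scope.

Let section (x : T1) (y : T2) : T3 := L (x, y).

Let measurable_section x : measurable_fun setT (section x).
Proof. exact: measurable_fun_pair2. Qed.

HB.instance Definition _ x :=
  isMeasurableFun.Build _ _ _ _ (section x) (measurable_section x).

Definition image_kernel (x : T1) : {measure set T3 -> \bar R} :=
  distribution P (section x).

Let measurable_image_kernel U :
  measurable U -> measurable_fun setT (image_kernel ^~ U).
Proof.
move=> mU; have mLU : measurable (L @^-1` U).
  by rewrite -[X in measurable X]setTI; exact: mL.
have := measurable_fun_xsection P mLU; congr measurable_fun.
by apply/funext => x /=; congr (P _); apply/seteqP; split => y;
  rewrite /xsection/= inE.
Qed.

HB.instance Definition _ :=
  isKernel.Build _ _ _ _ _ image_kernel measurable_image_kernel.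

Let prob_image_kernel x : image_kernel x setT = 1.
Proof. exact: probability_setT. Qed.

HB.instance Definition _ :=
  Kernel_isProbability.Build _ _ _ _ _ image_kernel prob_image_kernel.

Definition image_pker : R.-pker T1 ~> T3 := image_kernel.

(** Holds by unfolding: the product measure integrates over its first factor the measures of the
    sections. *)
Lemma disintegration1_image (mu : probability (T1 * T3)%type R) :
  same_measure (pushforward (marginal1 mu \x P) (fun p => (p.1, L p))) mu ->
  disintegration1 mu image_pker.
Proof. by move=> Lmu C mC; rewrite -Lmu. Qed.

(** The product integrates over its first factor [P], the disintegration over the second. The order
    is exchanged through [\x^], which agrees with [\x] on rectangles and hence everywhere. *)
Lemma disintegration2_image (mu : probability (T3 * T1)%type R) :
  same_measure (pushforward (P \x marginal2 mu)
    (fun p => (L (p.2, p.1), p.2))) mu ->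
  disintegration2 mu image_pker.
Proof.
move=> Lmu C mC; rewrite -Lmu//.
rewrite [LHS](_ : _ = (P \x^ marginal2 mu)
    ((fun p => (L (p.2, p.1), p.2)) @^-1` C)).
  by apply: eq_integral => x _; congr (P _); rewrite !ysectionE.
apply: product_measure_unique.
  by move=> A B mA mB; rewrite /= product_measure2E.
rewrite -[X in measurable X]setTI.
suff : measurable_fun setT (fun p : T2 * T1 => (L (p.2, p.1), p.2)) by exact.
apply: measurable_fun_pair; last exact: measurable_snd.
apply: (measurableT_comp mL); apply: measurable_fun_pair.
  exact: measurable_snd.
exact: measurable_fst.
Qed.

End image_kernel.

(** * Identification of the conditional measures *)

Section conditional.
Context d1 d2 (T1 : measurableType d1) (T2 : measurableType d2) (R : realType).
Variable mu : probability (T1 * T2)%type R.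
Local Open Scope ereal_scope.

Let swap (p : T1 * T2) := (p.2, p.1).

HB.instance Definition _ :=
  isMeasurableFun.Build _ _ _ _ swap (@measurable_swap _ _ T1 T2).

(** Exchanging the factors of [mu] reduces this to uniqueness over the first marginal. *)
Lemma disintegration2_ae_unique (G : (set T1)^nat) (k l : R.-pker T2 ~> T1) :
  countable_pi_base G -> disintegration2 mu k -> disintegration2 mu l ->
  {ae marginal2 mu, forall y, same_measure (k y) (l y)}.
Proof.
move=> bG dk dl.
have d21 (h : R.-pker T2 ~> T1) :
    disintegration2 mu h -> disintegration1 (distribution mu swap) h.
  move=> dh C mC; rewrite [LHS]dh; last first.
    by rewrite -[X in measurable X]setTI; exact: measurable_swap.
  by apply: eq_integral => y _; rewrite ysectionE xsectionE.
exact: (disintegration1_ae_unique bG (d21 _ dk) (d21 _ dl)).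
Qed.

(** The image kernel is a disintegration, which settles existence; almost everywhere uniqueness
    compares it with any other version. *)
Lemma conditional_measure1_image d3 (T3 : measurableType d3) (G : (set T2)^nat)
    (P : probability T3 R) (L : T1 * T3 -> T2) :
  countable_pi_base G -> measurable_fun setT L ->
  same_measure (pushforward (marginal1 mu \x P) (fun p => (p.1, L p))) mu ->
  conditional_measure1 mu (fun u => pushforward P (fun y => L (u, y))).
Proof.
move=> bG mL /(disintegration1_image mL) dL.
split=> [|k dk]; first by exists (image_pker P mL).
exact: disintegration1_ae_unique bG dL dk.
Qed.

Lemma conditional_measure2_image d3 (T3 : measurableType d3) (G : (set T1)^nat)
    (P : probability T3 R) (L : T3 * T2 -> T1) :
  countable_pi_base G -> measurable_fun setT L ->
  same_measure (pushforward (P \x marginal2 mu) (fun p => (L p, p.2))) mu ->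
  conditional_measure2 mu (fun f => pushforward P (fun x => L (x, f))).
Proof.
move=> bG mL Lmu.
have mLs : measurable_fun setT (fun p : T2 * T3 => L (p.2, p.1)).
  exact: (measurableT_comp mL (@measurable_swap _ _ T2 T3)).
have dL : disintegration2 mu (image_pker P mLs).
  by apply: disintegration2_image => C mC; rewrite -Lmu.
split=> [|k dk]; first by exists (image_pker P mLs).
exact: disintegration2_ae_unique bG dL dk.
Qed.

End conditional.

(** * Replacing a reference measure by a marginal of the target *)

Section triangular_pushforward.
Context d1 d2 d3 d4 (T1 : measurableType d1) (T2 : measurableType d2)
  (T3 : measurableType d3) (T4 : measurableType d4) (R : realType).
Local Open Scope ereal_scope.
Variables (P : probability T1 R) (Q : probability T2 R)
  (mu : probability (T3 * T4)%type R) (F : T1 * T2 -> T3 * T4).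
Hypothesis Fmu : same_measure (pushforward (P \x Q) F) mu.

(** [F] applies [f] to the first variable and then [fun p => (p.1, L p)], and [f] pushes [P] forward
    to the first marginal of [mu]. *)
Lemma same_measure_lower (f : T1 -> T3) (L : T3 * T2 -> T4) :
  measurable_fun setT f -> measurable_fun setT L ->
  (forall p, F p = (f p.1, L (f p.1, p.2))) ->
  same_measure (pushforward (marginal1 mu \x Q) (fun p => (p.1, L p))) mu.
Proof.
move=> mf mL FE C mC; rewrite -Fmu//.
set D := (fun p : T3 * T2 => (p.1, L p)) @^-1` C.
have mD : measurable D.
  rewrite -[X in measurable X]setTI.
  suff : measurable_fun setT (fun p : T3 * T2 => (p.1, L p)) by exact.
  by apply: measurable_fun_pair => //; exact: measurable_fst.
(* The marginal is written as a push-forward so that a change of variables returns to an integral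
   against [P]. *)
transitivity (\int[pushforward P f]_x Q (xsection D x)).
  apply: eq_measure_integral => A mA _.
  rewrite -[LHS](Fmu (A := fst @^-1` A)); last first.
    by rewrite -[X in measurable X]setTI; exact: measurable_fst.
  rewrite /pushforward (_ : _ @^-1` _ = (f @^-1` A) `*` setT); last first.
    by apply/seteqP; split => p /=; rewrite FE//= => -[].
  rewrite product_measure1E//.
    by rewrite [X in _ * X]probability_setT mule1.
  by rewrite -[X in measurable X]setTI; exact: mf.
rewrite ge0_integral_pushforward//; last exact: measurable_fun_xsection.
apply: eq_integral => x _ /=; congr (Q _).
by rewrite !xsectionE /D; apply/seteqP; split => y /=; rewrite FE.
Qed.

(** Both outer integrals are against [P], so the sections at each [x] are compared, using that the
    second marginal of [mu] is the push-forward of [Q] under [f]. *)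
Lemma same_measure_upper (f : T2 -> T4) (L : T1 * T4 -> T3) :
  measurable_fun setT f -> measurable_fun setT L ->
  (forall p, F p = (L (p.1, f p.2), f p.2)) ->
  same_measure (pushforward (P \x marginal2 mu) (fun p => (L p, p.2))) mu.
Proof.
move=> mf mL FE C mC; rewrite -Fmu//.
apply: eq_integral => x _ /=.
set D := (X in distribution _ _ X = _).
have mD : measurable D.
  apply: measurable_xsection.
  rewrite -[X in measurable X]setTI.
  suff : measurable_fun setT (fun p : T1 * T4 => (L p, p.2)) by exact.
  by apply: measurable_fun_pair => //; exact: measurable_snd.
rewrite /= -[LHS](Fmu (A := snd @^-1` D)); last first.
  by rewrite -[X in measurable X]setTI; exact: measurable_snd.
rewrite /pushforward.
rewrite (_ : F @^-1` (_ @^-1` D) = setT `*` (f @^-1` D)); last first.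
  by apply/seteqP; split => p /=; rewrite FE//= => -[].
rewrite product_measure1E//; last first.
  by rewrite -[X in measurable X]setTI; exact: mf.
rewrite [X in X * _]probability_setT mul1e; congr (Q _).
by rewrite /D !xsectionE; apply/seteqP; split => y /=; rewrite FE.
Qed.

End triangular_pushforward.

(** * The likelihood and posterior maps of triangular transports *)

Lemma pinv_eq (A B : Type) (f : A -> B) (g : B -> A) (d : B -> A) :
  is_inverse f g -> 'pinv_d setT f = g.
Proof.
move=> [fK gK]; apply/funext => u; apply: (can_inj fK).
(* [g u] shows that [u] lies in the range of [f], where the partial inverse is genuine. *)
by rewrite pinvK ?gK// inE; exists (g u).
Qed.

Section components.
Context {R : realType} {n m : nat}.
Local Notation RnRm := ('rV[R]_n * 'rV[R]_m)%type.
Implicit Types F G : RnRm -> RnRm.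

Lemma lower_fstE F p : lower_triangular F -> (F p).1 = lower_fst F p.1.
Proof. by case: p => x y tF; exact: lower_triangular_fst. Qed.

Lemma upper_sndE F p : upper_triangular F -> (F p).2 = upper_snd F p.2.
Proof. by case: p => x y tF; exact: upper_triangular_snd. Qed.

(** By triangularity the placeholder [0] may be replaced by the second component of the image point,
    after which the full inverses cancel. *)
Lemma lower_fst_inverse F G :
  invertible_lower_triangular F G -> is_inverse (lower_fst F) (lower_fst G).
Proof.
move=> [[FK GK] tF tG]; split=> x; rewrite /lower_fst.
  by rewrite (lower_triangular_fst _ 0 (F (x, 0)).2 tG) -surjective_pairing FK.
by rewrite (lower_triangular_fst _ 0 (G (x, 0)).2 tF) -surjective_pairing GK.
Qed.

Lemma upper_snd_inverse F G :
  invertible_upper_triangular F G -> is_inverse (upper_snd F) (upper_snd G).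
Proof.
move=> [[FK GK] tF tG]; split=> y; rewrite /upper_snd.
  by rewrite (upper_triangular_snd 0 (F (0, y)).1 _ tG) -surjective_pairing FK.
by rewrite (upper_triangular_snd 0 (G (0, y)).1 _ tF) -surjective_pairing GK.
Qed.

Lemma measurable_lower F : lower_triangular F -> measurable_fun setT F.
Proof. by move=> tF; apply: measurable_flatten_map => v; exact: (tF v).1. Qed.

Lemma measurable_upper F : upper_triangular F -> measurable_fun setT F.
Proof. by move=> tF; apply: measurable_flatten_map => v; exact: (tF v).1. Qed.

Lemma measurable_lower_fst F :
  lower_triangular F -> measurable_fun setT (lower_fst F).
Proof.
move=> tF.
have mF := measurable_lower tF.
have mF0 := measurable_fun_pair1 (0 : 'rV[R]_m) mF.
by have := measurableT_comp measurable_fst mF0.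
Qed.

Lemma measurable_upper_snd F :
  upper_triangular F -> measurable_fun setT (upper_snd F).
Proof.
move=> tF.
have mF := measurable_upper tF.
have mF0 := measurable_fun_pair2 (0 : 'rV[R]_n) mF.
by have := measurableT_comp measurable_snd mF0.
Qed.

(** [likelihood_map] and [posterior_map] are the bijections T and W of the opening comment; the
    other two are their inverses. *)
Definition likelihood_map F p : RnRm := (p.1, F_like F p.1 p.2).
Definition likelihood_inv G p : RnRm := (p.1, F_like_inv G p.1 p.2).
Definition posterior_map F p : RnRm := (F_post F p.2 p.1, p.2).
Definition posterior_inv G p : RnRm := (F_post_inv G p.2 p.1, p.2).

Section lower.
Variables F G : RnRm -> RnRm.
Hypothesis FG : invertible_lower_triangular F G.

(** The partial inverse inside [F_like] is [lower_fst G], and [lower_fst F] undoes it. In this form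
    the map inherits inversion and measurability from [F] and [G]. *)
Lemma likelihood_mapE p : likelihood_map F p = F (lower_fst G p.1, p.2).
Proof.
case: FG => _ tF _; rewrite [RHS]surjective_pairing lower_fstE//=.
rewrite /likelihood_map /F_like (pinv_eq _ (lower_fst_inverse FG)).
by rewrite (lower_fst_inverse FG).2.
Qed.

Lemma likelihood_invE p : likelihood_inv G p = (p.1, (G p).2).
Proof. by case: p. Qed.

Lemma likelihood_inverse : is_inverse (likelihood_map F) (likelihood_inv G).
Proof.
case: (FG) => -[FK GK] tF tG; split => p.
  rewrite likelihood_invE {2}likelihood_mapE FK.
  by rewrite [RHS]surjective_pairing.
rewrite likelihood_mapE likelihood_invE /=.
(* The argument of [F] reassembles to [G p], since [lower_fst G p.1] is its first component. *)
by rewrite -(lower_fstE _ tG) -surjective_pairing GK.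
Qed.

Lemma measurable_F_like : measurable_fun setT (fun p => F_like F p.1 p.2).
Proof.
case: (FG) => _ tF tG.
have mF := measurable_lower tF.
rewrite (_ : (fun _ => _) = snd \o F \o (fun p => (lower_fst G p.1, p.2))).
  apply: measurableT_comp; first exact: measurableT_comp measurable_snd mF.
  apply: measurable_fun_pair; last exact: measurable_snd.
  exact: measurableT_comp (measurable_lower_fst tG) measurable_fst.
by apply/funext => p; rewrite /= -likelihood_mapE.
Qed.

Lemma measurable_likelihood_map : measurable_fun setT (likelihood_map F).
Proof. exact: measurable_fun_pair measurable_fst measurable_F_like. Qed.

Lemma measurable_likelihood_inv : measurable_fun setT (likelihood_inv G).
Proof.
case: (FG) => _ _ tG.
have mG := measurable_lower tG.
rewrite (_ : likelihood_inv G = (fun p => (p.1, (G p).2))); last first.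
  by apply/funext => p; exact: likelihood_invE.
apply: measurable_fun_pair; first exact: measurable_fst.
exact: measurableT_comp measurable_snd mG.
Qed.

End lower.

Section upper.
Variables F G : RnRm -> RnRm.
Hypothesis FG : invertible_upper_triangular F G.

Lemma posterior_mapE p : posterior_map F p = F (p.1, upper_snd G p.2).
Proof.
case: FG => _ tF _; rewrite [RHS]surjective_pairing upper_sndE//=.
rewrite /posterior_map /F_post (pinv_eq _ (upper_snd_inverse FG)).
by rewrite (upper_snd_inverse FG).2.
Qed.

Lemma posterior_invE p : posterior_inv G p = ((G p).1, p.2).
Proof. by case: p. Qed.

Lemma posterior_inverse : is_inverse (posterior_map F) (posterior_inv G).
Proof.
case: (FG) => -[FK GK] tF tG; split => p.
  rewrite posterior_invE {1}posterior_mapE FK.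
  by rewrite [RHS]surjective_pairing.
rewrite posterior_mapE posterior_invE /=.
by rewrite -(upper_sndE _ tG) -surjective_pairing GK.
Qed.

Lemma measurable_F_post : measurable_fun setT (fun p => F_post F p.2 p.1).
Proof.
case: (FG) => _ tF tG.
have mF := measurable_upper tF.
rewrite (_ : (fun _ => _) = fst \o F \o (fun p => (p.1, upper_snd G p.2))).
  apply: measurableT_comp; first exact: measurableT_comp measurable_fst mF.
  apply: measurable_fun_pair; first exact: measurable_fst.
  exact: measurableT_comp (measurable_upper_snd tG) measurable_snd.
by apply/funext => p; rewrite /= -posterior_mapE.
Qed.

Lemma measurable_posterior_map : measurable_fun setT (posterior_map F).
Proof. exact: measurable_fun_pair measurable_F_post measurable_snd. Qed.

Lemma measurable_posterior_inv : measurable_fun setT (posterior_inv G).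
Proof.
case: (FG) => _ _ tG.
have mG := measurable_upper tG.
rewrite (_ : posterior_inv G = (fun p => ((G p).1, p.2))); last first.
  by apply/funext => p; exact: posterior_invE.
apply: measurable_fun_pair; last exact: measurable_snd.
exact: measurableT_comp measurable_fst mG.
Qed.

End upper.

Variables (muX : probability 'rV[R]_n R) (muY : probability 'rV[R]_m R)
  (muUF : probability RnRm R).

Lemma likelihood_map_pushforward F G : invertible_lower_triangular F G ->
  same_measure (pushforward (muX \x muY)%E F) muUF ->
  same_measure (pushforward (marginal1 muUF \x muY)%E (likelihood_map F)) muUF.
Proof.
move=> FG Fmu; case: (FG) => -[FK _] tF _.
apply: (same_measure_lower Fmu (f := lower_fst F)
  (L := fun p => F_like F p.1 p.2)).
- exact: measurable_lower_fst tF.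
- exact: measurable_F_like FG.
(* [likelihood_map F] starts with [lower_fst G], which cancels [lower_fst F] and leaves [F p]. *)
- move=> p; rewrite -[RHS]/(likelihood_map F (lower_fst F p.1, p.2)).
  rewrite (likelihood_mapE FG)/= (lower_fst_inverse FG).1.
  by rewrite -surjective_pairing.
Qed.

Lemma posterior_map_pushforward F G : invertible_upper_triangular F G ->
  same_measure (pushforward (muX \x muY)%E F) muUF ->
  same_measure (pushforward (muX \x marginal2 muUF)%E (posterior_map F)) muUF.
Proof.
move=> FG Fmu; case: (FG) => -[FK _] tF _.
apply: (same_measure_upper Fmu (f := upper_snd F)
  (L := fun p => F_post F p.2 p.1)).
- exact: measurable_upper_snd tF.
- exact: measurable_F_post FG.
- move=> p; rewrite -[RHS]/(posterior_map F (p.1, upper_snd F p.2)).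
  rewrite (posterior_mapE FG)/= (upper_snd_inverse FG).1.
  by rewrite -surjective_pairing.
Qed.

End components.

(** Pushing [nu] forward by [h] gives [rho], because [nu] is the image of [rho] under [g] and [h]
    undoes [g]. *)
Lemma same_measure_inverse d1 d2 d3 (T1 : measurableType d1)
    (T2 : measurableType d2) (T3 : measurableType d3) (R : realType)
    (mu : set T1 -> \bar R) (nu : set T2 -> \bar R) (rho : set T3 -> \bar R)
    (f : T1 -> T2) (g : T3 -> T2) (h : T2 -> T3) :
  same_measure (pushforward mu f) nu -> same_measure (pushforward rho g) nu ->
  cancel g h -> measurable_fun setT h ->
  same_measure (pushforward mu (h \o f)) rho.
Proof.
move=> fnu gnu gK mh A mA.
have mhA : measurable (h @^-1` A).
  by rewrite -[X in measurable X]setTI; exact: mh.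
rewrite -[LHS]/(pushforward mu f (h @^-1` A)) fnu// -gnu// /pushforward.
by congr rho; apply/funext => x /=; rewrite gK.
Qed.

Theorem theorem3p4 (R : realType) (n m : nat)
    (muX : probability 'rV[R]_n R) (muY : probability 'rV[R]_m R)
    (muUF : probability ('rV[R]_n * 'rV[R]_m)%type R)
    (lowF lowG upF upG : 'rV[R]_n * 'rV[R]_m -> 'rV[R]_n * 'rV[R]_m) :
  invertible_lower_triangular lowF lowG ->
  invertible_upper_triangular upF upG ->
  same_measure (pushforward (muX \x muY)%E lowF) muUF ->
  same_measure (pushforward (muX \x muY)%E upF) muUF ->
  let S := simulator_S lowF upG in
  let S' := simulator_R lowG upF in
  is_inverse S S' /\ reversible_simulator muX muY muUF S S'.
Proof.
move=> low up lowmu upmu S S'.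
have [likeK like_invK] := likelihood_inverse low.
have [postK post_invK] := posterior_inverse up.
have SE : S = posterior_inv upG \o likelihood_map lowF.
  by apply/funext => -[].
have S'E : S' = likelihood_inv lowG \o posterior_map upF.
  by apply/funext => -[].
have SS' : is_inverse S S'.
  by rewrite SE S'E; split => p /=; rewrite ?post_invK ?likeK ?like_invK ?postK.
have likemu := likelihood_map_pushforward low lowmu.
have postmu := posterior_map_pushforward up upmu.
have mlike_inv := measurable_likelihood_inv low.
have mpost_inv := measurable_posterior_inv up.
split=> //; split=> //.
- rewrite SE; exact: measurableT_comp mpost_inv (measurable_likelihood_map low).
- rewrite S'E; exact: measurableT_comp mlike_inv (measurable_posterior_map up).
- have [G bG] := @rV_countable_pi_base R m.
  exact: conditional_measure1_image bG (measurable_F_like low) likemu.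
- have [G bG] := @rV_countable_pi_base R n.
  exact: conditional_measure2_image bG (measurable_F_post up) postmu.
(* The likelihood and posterior maps both push their product measure to [muUF]; inverting the
   posterior one gives (iii), inverting the likelihood one gives (iv). *)
- rewrite SE; exact: same_measure_inverse likemu postmu postK mpost_inv.
- rewrite S'E; exact: same_measure_inverse postmu likemu likeK mlike_inv.
Qed.
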